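(* Let $\Gamma$ be a finitely generated group and let $\alpha:\Gamma\to\Gamma$ be an endomorphism of $\Gamma$. For every real number $r>1$ define $H_r=\{\gamma\in\Gamma:\ \limsup_{n\to\infty}\sqrt[n]{|\alpha^n(\gamma)|}\le r\}$. Then the growth rate $GR(\alpha)$ of $\alpha$ is the smallest value of $r$ such that $H_r=\Gamma$.
   Context: Fix a finite generating set $S$ of $\Gamma$; $|\gamma|=|\gamma|_S$ denotes the length of the shortest word in the letters $S\cup S^{-1}$ representing $\gamma\in\Gamma$. The growth rate of an endomorphism $\alpha:\Gamma\to\Gamma$ is $GR(\alpha)=\sup_{\gamma\in\Gamma}\ \limsup_{m\to\infty}\sqrt[m]{|\alpha^m(\gamma)|}$.
   Formalization: H_r is taken for every real r, not only r>1; the claim with r restricted to r>1 is stated only when GR(α)>1, since it fails otherwise (for the identity of Z, GR=1 and H_r=Γ for all r>1, so there is no smallest r>1). *)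

(* Defs.v *)
From HB Require Import structures.
From mathcomp Require Import all_boot all_order all_algebra.
From mathcomp Require Import all_classical all_reals all_analysis.

Set Implicit Arguments.
Unset Strict Implicit.
Unset Printing Implicit Defensive.

Import Order.TTheory GRing.Theory Num.Theory.
Import numFieldNormedType.Exports.

Local Open Scope classical_set_scope.
Local Open Scope ring_scope.

Definition is_word (G : groupType) (S : set G) (w : seq G) : Prop :=
  forall x, x \in w -> S x \/ S (x^-1)%g.

Definition spells (G : groupType) (S : set G) (g : G) : pred nat :=
  fun n => `[< exists w : seq G,
    [/\ is_word S w, size w = n & (\prod_(x <- w) x)%g = g] >].

Definition generates (G : groupType) (S : set G) : Prop :=
  forall g : G, exists2 w : seq G, is_word S w & (\prod_(x <- w) x)%g = g.

Lemma spells_ex (G : groupType) (S : set G) (genS : generates S) (g : G) :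
  exists n, spells S g n.
Proof.
by have [w Sw <-] := genS g; exists (size w); apply/asboolP; exists w.
Qed.

Definition word_length (G : groupType) (S : set G) (genS : generates S)
  (g : G) : nat := ex_minn (spells_ex genS g).

(* The value of the sequence at n = 0 is the convention x `^ 0 = 1; it does
   not affect the limsup. *)
Definition orbit_growth (R : realType) (G : groupType) (S : set G)
  (genS : generates S) (alpha : {multiplicative G -> G}) (g : G) : \bar R :=
  limn_esup (fun n : nat =>
    (((word_length genS (iter n alpha g))%:R : R) `^ (n%:R^-1))%:E).

Definition growth_rate (R : realType) (G : groupType) (S : set G)
  (genS : generates S) (alpha : {multiplicative G -> G}) : \bar R :=
  ereal_sup [set orbit_growth R genS alpha g | g in [set: G]].

(* r ranges over all reals: if the growth rate is at most 1 (e.g. for the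
   identity or a trivial endomorphism), no smallest r with Hset r = setT exists
   among r > 1. *)
Definition Hset (R : realType) (G : groupType) (S : set G)
  (genS : generates S) (alpha : {multiplicative G -> G}) (r : R) : set G :=
  [set g | (orbit_growth R genS alpha g <= r%:E)%E].

Definition is_smallest (R : realType) (A : set R) (m : R) : Prop :=
  A m /\ lbound A m.

(* Main.v *)
Require Import Defs.
From HB Require Import structures.
From mathcomp Require Import all_boot all_order all_algebra.
From mathcomp Require Import all_classical all_reals all_analysis.

Import Order.TTheory GRing.Theory Num.Theory.

Local Open Scope classical_set_scope.
Local Open Scope ring_scope.

(** Apart from the existence of a real value, the statement is the universal
    property of a supremum: [Hset r] is the whole group exactly when [r] is an
    upper bound of all orbit growths, and the growth rate is their least upper
    bound.

    What has to be proved is that the supremum is finite.  It is nonnegative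
    because every sequence involved is.  For the upper bound, let [M] bound the
    lengths of the images under [alpha] of the finitely many letters.  Applying
    [alpha] letter by letter to a shortest word gives
    [|alpha g| <= M * |g|], hence [|alpha^n g| <= M ^ n * |g|].  The factor
    [|g|] disappears from the estimate once [n >= |g|], since then
    [|g| <= 2 ^ n]: the [n]-th root is eventually at most [2 * M], a bound that
    does not depend on [g] ([orbit_growth_le]). *)

Section WordLength.
Variables (G : groupType) (S : set G) (genS : generates S).

Lemma word_length_le (w : seq G) :
  is_word S w -> (word_length genS (\prod_(x <- w) x)%g <= size w)%N.
Proof.
move=> Sw; rewrite /word_length; case: ex_minnP => n _; apply.
by apply/asboolP; exists w.
Qed.

Lemma word_length_attained (g : G) :
  exists w : seq G,
    [/\ is_word S w, size w = word_length genS g & (\prod_(x <- w) x)%g = g].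
Proof. by rewrite /word_length; case: ex_minnP => n /asboolP. Qed.

Lemma word_length1 : word_length genS 1%g = 0%N.
Proof.
apply/eqP; rewrite -leqn0.
by have := @word_length_le [::]; rewrite big_nil; apply.
Qed.

Lemma word_lengthM (g h : G) :
  (word_length genS (g * h)%g <= word_length genS g + word_length genS h)%N.
Proof.
have [u [Su <- <-]] := word_length_attained g.
have [v [Sv <- <-]] := word_length_attained h.
rewrite -size_cat -big_cat; apply: word_length_le => x.
by rewrite mem_cat => /orP[/Su|/Sv].
Qed.

Lemma letters_bounded (F : G -> nat) : finite_set S ->
  exists M : nat, forall x, S x \/ S (x^-1)%g -> (F x <= M)%N.
Proof.
move=> /finite_seqP[s ->]; exists (\max_(x <- s ++ [seq (y^-1)%g | y <- s]) F x).
move=> x sx; apply: leq_bigmax_seq => //; rewrite mem_cat.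
case: sx => /= [->//|sx]; apply/orP; right.
by apply/mapP; exists (x^-1)%g; rewrite ?invgK.
Qed.

Variable alpha : {multiplicative G -> G}.

Lemma endo1 : alpha 1%g = 1%g.
Proof. by apply: (mulgI (alpha 1%g)); rewrite -gmulfM !mulg1. Qed.

Variable M : nat.
Hypothesis alphaM :
  forall x, S x \/ S (x^-1)%g -> (word_length genS (alpha x) <= M)%N.

Lemma word_length_endo (g : G) :
  (word_length genS (alpha g) <= M * word_length genS g)%N.
Proof.
have [w [Sw <- <-]] := word_length_attained g.
elim: w Sw => [|x w IHw] Sw; first by rewrite big_nil endo1 word_length1.
rewrite big_cons gmulfM mulnS (leq_trans (word_lengthM _ _))// leq_add//.
  by apply/alphaM/Sw/mem_head.
by apply: IHw => y wy; apply: Sw; rewrite inE wy orbT.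
Qed.

Lemma word_length_iter_endo (n : nat) (g : G) :
  (word_length genS (iter n alpha g) <= M ^ n * word_length genS g)%N.
Proof.
elim: n => [|n IHn]; first by rewrite mul1n.
by rewrite iterS (leq_trans (word_length_endo _))// expnS -mulnA leq_mul2l IHn orbT.
Qed.

End WordLength.

Lemma limn_esup_le_near (R : realType) (u : nat -> \bar R) (c : \bar R) :
  (\forall n \near \oo, (u n <= c)%E) -> (limn_esup u <= c)%E.
Proof.
move=> uc; apply: (@le_trans _ _ (ereal_sup (u @` [set n | (u n <= c)%E]))).
  by apply: ereal_inf_lbound; exists [set n | (u n <= c)%E].
by apply: ge_ereal_sup => _ [n un <-].
Qed.

Lemma orbit_growth_ge0 (R : realType) (G : groupType) (S : set G)
    (genS : generates S) (alpha : {multiplicative G -> G}) (g : G) :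
  (0 <= orbit_growth R genS alpha g)%E.
Proof.
apply: limf_esup_ge0 => [|n]; first exact: filter_not_empty.
by rewrite lee_fin powR_ge0.
Qed.

(** The bound [2 * M] is wasteful, but it is independent of [g] and avoids
    taking the limit of the [n]-th roots of [|g|]. *)
Lemma orbit_growth_le (R : realType) (G : groupType) (S : set G)
    (genS : generates S) (alpha : {multiplicative G -> G}) (M : nat)
    (alphaM : forall x, S x \/ S (x^-1)%g -> (word_length genS (alpha x) <= M)%N)
    (g : G) :
  (orbit_growth R genS alpha g <= (2 * M)%:R%:E)%E.
Proof.
apply: limn_esup_le_near.
exists (word_length genS g).+1 => // n /= lt_gn.
have n0 : n%:R != 0 :> R by rewrite pnatr_eq0; case: n lt_gn.
have len : (word_length genS (iter n alpha g) <= (2 * M) ^ n)%N.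
  rewrite (leq_trans (word_length_iter_endo _ _ _ _ _ alphaM n g))//.
  rewrite expnMn mulnC leq_mul2r (leq_trans (ltnW lt_gn)) ?orbT//.
  exact/ltnW/ltn_expl.
have -> : (2 * M)%:R = ((2 * M) ^ n)%:R `^ n%:R^-1 :> R.
  by rewrite natrX -powR_mulrn// -powRrM divff// powRr1.
by rewrite lee_fin ge0_ler_powR ?nnegrE ?invr_ge0 ?ler_nat.
Qed.

Theorem lemma2p1 (R : realType) (G : groupType) (S : set G)
    (finS : finite_set S) (genS : generates S)
    (alpha : {multiplicative G -> G}) :
  exists GR : R,
    [/\ growth_rate R genS alpha = GR%:E,
        is_smallest [set r : R | Hset genS alpha r = [set: G]] GR
      & 1 < GR ->
        is_smallest [set r : R | 1 < r /\ Hset genS alpha r = [set: G]] GR].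
Proof.
have [M alphaM] := letters_bounded _ _ (fun x => word_length genS (alpha x)) finS.
have HsetT (r : R) :
    Hset genS alpha r = [set: G] <-> (growth_rate R genS alpha <= r%:E)%E.
  split=> [HT|le_r].
    apply: ge_ereal_sup => _ [g _ <-].
    by have : [set: G] g by []; rewrite -HT.
  apply/seteqP; split=> // g _; apply: (le_trans _ le_r).
  by apply: ereal_sup_ubound; exists g.
have fin : growth_rate R genS alpha \is a fin_num.
  have ge0 : (0 <= growth_rate R genS alpha)%E.
    apply: (le_trans (orbit_growth_ge0 R _ _ genS alpha 1%g)).
    by apply: ereal_sup_ubound; exists 1%g.
  rewrite ge0_fin_numE//; apply: (le_lt_trans _ (ltry (2 * M)%:R)).
  by apply: ge_ereal_sup => _ [g _ <-]; exact: orbit_growth_le.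
exists (fine (growth_rate R genS alpha)).
have HsetGR : Hset genS alpha (fine (growth_rate R genS alpha)) = [set: G].
  by apply/HsetT; rewrite fineK.
have leGR r : Hset genS alpha r = [set: G] -> fine (growth_rate R genS alpha) <= r.
  by move=> /HsetT; rewrite -lee_fin fineK.
split; [by rewrite fineK | by [] |].
by move=> GR1; split=> // r [_ /leGR].
Qed.
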